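(* Consider the problem $\min_{x\in\mathbb{R}^n} f(x)+\sum_{i=1}^n g_i(x_i)$, where $f:\mathbb{R}^n\to\mathbb{R}$ is convex with $L$-Lipschitz continuous gradient ($L>0$) and each $g_i:\mathbb{R}\to\mathbb{R}\cup\{+\infty\}$ is a proper, lower semi-continuous, convex function whose subdifferential is nonempty at every point of its domain. Let $x^*$ be a nondegenerate optimal solution, and let $(x^k)_{k\ge0}$ be generated by a proximal-gradient block coordinate descent method with step-size $1/L$ (with any block selection rule) that satisfies, for some $\gamma\ge 0$ and $\kappa\ge 1$, $$\|x^k-x^*\|\le\Big(1-\frac1\kappa\Big)^k\gamma\qquad\text{for all }k\ge0.$$ Then, with $\delta$ and $\mathcal{Z}$ defined in the context: (1) $\|x^{k}-x^*\|\le\delta/(2L)$ for every integer $k\ge 0$ with $k\ge\kappa\log(2L\gamma/\delta)$; that is, this distance is reached after at most $\kappa\log(2L\gamma/\delta)$ iterations. (2) Let $\bar k\ge 0$ be the smallest integer with $\bar k\ge\kappa\log(2L\gamma/\delta)$, and let $t$ be the number of additional iterations required to select all suboptimal $x_i$ with $i\in\mathcal{Z}$ as part of some block, i.e. every $i\in\mathcal{Z}$ with $x_i^{\bar k}\neq x_i^*$ belongs to at least one of the blocks $b_{\bar k},b_{\bar k+1},\dots,b_{\bar k+t-1}$. Then the active set is identified after these additional $t$ iterations: $x_i^k=x_i^*$ for all $i\in\mathcal{Z}$ and all $k\ge\bar k+t$.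
   Context: Proximal-gradient block coordinate descent with step-size $1/L$: at iteration $k$ a nonempty block $b_k\subseteq\{1,\dots,n\}$ is selected; for $i\in b_k$, $$x_i^{k+1}=\arg\min_{y\in\mathbb{R}}\Big\{\tfrac{L}{2}\big(y-(x_i^k-\tfrac1L\nabla_i f(x^k))\big)^2+g_i(y)\Big\},$$ and $x_j^{k+1}=x_j^k$ for $j\notin b_k$. Subdifferential: $\partial g_i(x_i)=\{v\in\mathbb{R}: g_i(y)\ge g_i(x_i)+v(y-x_i)\text{ for all }y\in\mathrm{dom}(g_i)\}$, an interval of the real line. Active set: $\mathcal{Z}=\{i:\partial g_i(x_i^* )\text{ is not a singleton}\}$. For $i\in\mathcal{Z}$ write $\mathrm{int}\,\partial g_i(x_i^* )=(l_i,u_i)$ with $l_i\in\mathbb{R}\cup\{-\infty\}$, $u_i\in\mathbb{R}\cup\{+\infty\}$. Nondegenerate solution: for every $i$, $-\nabla_i f(x^* )=\nabla g_i(x_i^* )$ when $\partial g_i(x_i^* )$ is a singleton (here $\nabla g_i(x_i^* )$ denotes its unique element), and $-\nabla_i f(x^* )\in\mathrm{int}\,\partial g_i(x_i^* )$ when it is not. The quantity $\delta$ is $$\delta=\min_{i\in\mathcal{Z}}\big\{\min\{-\nabla_i f(x^* )-l_i,\ u_i+\nabla_i f(x^* )\}\big\},$$ which is positive by nondegeneracy. Conventions: $\delta=+\infty$ if $\mathcal{Z}=\emptyset$; if $\gamma=0$ or $\delta=+\infty$ then $\kappa\log(2L\gamma/\delta)$ is read as $-\infty$ (so $\bar k=0$).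 The norm $\|\cdot\|$ is Euclidean and $\log$ is the natural logarithm. *)

(* Defs.v *)
From HB Require Import structures.
From mathcomp Require Import all_boot all_order all_algebra.
From mathcomp Require Import all_classical all_reals all_analysis.

Set Implicit Arguments.
Unset Strict Implicit.
Unset Printing Implicit Defensive.

Import Order.TTheory GRing.Theory Num.Theory.
Import numFieldNormedType.Exports.

Local Open Scope classical_set_scope.
Local Open Scope ring_scope.

Section Vectors.
Context {R : realType} {n : nat}.
Implicit Types (f : 'rV[R]_n -> R) (x : 'rV[R]_n).

(* The library norm on 'rV[R]_n is the max norm, hence this definition. *)
Definition enorm x : R := Num.sqrt (\sum_(i < n) x ord0 i ^+ 2).

Definition partial f (i : 'I_n) x : R := 'D_(delta_mx ord0 i) f x.

Definition gradient f x : 'rV[R]_n := \row_i partial f i x.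

Definition lipschitz_gradient (L : R) f :=
  (forall x, differentiable f x) /\
  (forall x y, enorm (gradient f x - gradient f y) <= L * enorm (x - y)).

End Vectors.

Section ExtendedRealFunctions.
Context {R : realType}.
Implicit Types (h : R -> \bar R) (x : R).
Local Open Scope ereal_scope.

Definition dom h : set R := [set x | h x < +oo].

Definition proper_fun h := (forall x, -oo < h x) /\ dom h !=set0.

(* 0 * +oo = 0 in \bar R, so the weights 0 and 1 impose nothing. *)
Definition econvex h := forall (x y t : R), (0 <= t <= 1)%R ->
  h (t * x + (1 - t) * y)%R <= t%:E * h x + (1 - t)%:E * h y.

Definition subdifferential h x : set R :=
  [set v | forall y, dom h y -> h x + (v * (y - x))%:E <= h y].

Definition is_singleton (A : set R) := exists v, A = [set v].

Definition argmin h : set R := [set z | forall y, h z <= h y].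

(* interior_subdifferentialE below: the interior of the subdifferential is
   the interval ]int_lower h x, int_upper h x[. *)
Definition int_lower h x : \bar R :=
  ereal_inf (EFin @` (subdifferential h x)°).

Definition int_upper h x : \bar R :=
  ereal_sup (EFin @` (subdifferential h x)°).

Lemma subdifferential_interval h x : is_interval (subdifferential h x).
Proof.
move=> a b ha hb c /andP[ac cb] y hy.
have [xy|yx] := leP x y.
- apply: le_trans (hb y hy); rewrite leeD2l// lee_fin ler_wpM2r//.
  by rewrite subr_ge0.
- apply: le_trans (ha y hy); rewrite leeD2l// lee_fin ler_wnM2r//.
  by rewrite subr_le0 ltW.
Qed.

Lemma interior_subdifferentialE h x :
  (subdifferential h x)° =
  [set v | int_lower h x < v%:E /\ v%:E < int_upper h x].
Proof.
apply/seteqP; split=> v /=.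
- move=> hv.
  have /nbhs_ballP[e /= e0 he] : nbhs v ((subdifferential h x)°).
    exact: nbhs_interior.
  split.
  + apply: (@le_lt_trans _ _ (v - e / 2)%:E).
      apply: ereal_inf_lbound; exists (v - e / 2)%R => //; apply: he.
      rewrite /ball/= opprB addrC subrK ger0_norm ?divr_ge0 ?ltW//.
      by rewrite ltr_pdivrMr// ltr_pMr// ltr1n.
    by rewrite lte_fin ltrBlDr ltrDl divr_gt0.
  + apply: (@lt_le_trans _ _ (v + e / 2)%:E).
      by rewrite lte_fin ltrDl divr_gt0.
    apply: ereal_sup_ubound; exists (v + e / 2)%R => //; apply: he.
    rewrite /ball/= opprD addrA subrr sub0r normrN ger0_norm ?divr_ge0 ?ltW//.
    by rewrite ltr_pdivrMr// ltr_pMr// ltr1n.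
- move=> [/ereal_inf_lt[_ [a ha <-]] av] /=.
  move: av => /[swap] /ereal_sup_gt[_ [b hb <-]] vb av.
  rewrite !lte_fin in av vb.
  have : nbhs v [set` `]a, b[].
    by apply: near_in_itvoo; rewrite in_itv/= av vb.
  apply: filterS => c /=; rewrite in_itv/= => /andP[ac cb].
  apply: (subdifferential_interval (interior_subset ha) (interior_subset hb)).
  by rewrite !ltW.
Qed.

End ExtendedRealFunctions.

Section CompositeProblem.
Context {R : realType} {n : nat}.
Variables (f : 'rV[R]_n -> R) (g : 'I_n -> R -> \bar R).
Local Open Scope ereal_scope.

Definition objective (x : 'rV[R]_n) : \bar R :=
  (f x)%:E + \sum_(i < n) g i (x ord0 i).

Definition optimal (xs : 'rV[R]_n) := forall y, objective xs <= objective y.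

Definition nondegenerate_solution (xs : 'rV[R]_n) := forall i : 'I_n,
  let D := subdifferential (g i) (xs ord0 i) in
  (forall v, D = [set v] -> (- partial f i xs)%R = v) /\
  (~ is_singleton D -> D° (- partial f i xs)%R).

Definition active_set (xs : 'rV[R]_n) : {set 'I_n} :=
  finset (fun i => ~~ `[< is_singleton (subdifferential (g i) (xs ord0 i)) >]).

(* The minimum over an empty active set is +oo. *)
Definition delta (xs : 'rV[R]_n) : \bar R :=
  \big[Order.min/+oo]_(i in active_set xs)
    Order.min ((- partial f i xs)%:E - int_lower (g i) (xs ord0 i))
              (int_upper (g i) (xs ord0 i) + (partial f i xs)%:E).

(* lne 0 = -oo and +oo^-1 = 0, so for kappa > 0 this is -oo if gamma = 0 or
   delta = +oo. *)
Definition threshold (L gamma kappa : R) (xs : 'rV[R]_n) : \bar R :=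
  kappa%:E * lne ((2 * L * gamma)%:E / delta xs).

Definition prox_bcd (L : R) (b : nat -> {set 'I_n}) (x : nat -> 'rV[R]_n) :=
  forall k, b k != finset.set0 /\
  forall i, if i \in b k
    then argmin (fun y =>
           (L / 2 * (y - (x k ord0 i - 1 / L * partial f i (x k))) ^+ 2)%:E
           + g i y) (x k.+1 ord0 i)
    else x k.+1 ord0 i = x k ord0 i.

End CompositeProblem.

Definition least_nat (P : nat -> Prop) (m : nat) :=
  P m /\ forall j, P j -> (m <= j)%N.

(* Main.v *)
(* A proximal step at coordinate i fixes xs_i exactly when
   v = L (x_i - xs_i) - partial_i f x lies in the subdifferential of g_i at
   xs_i.  Since |v + partial_i f xs| <= 2 L |x - xs|, this happens as soon as
   |x - xs| <= delta / (2 L): the point v is then in the closure of the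
   interval int_lower, int_upper, and subdifferentials are closed.  The rate
   reaches this radius in kappa log(2 L gamma / delta) steps because
   1 - 1/kappa <= exp(- 1/kappa).  From then on a selected active coordinate
   jumps to xs_i and stays there. *)
Require Import Defs.
From HB Require Import structures.
From mathcomp Require Import all_boot all_order all_algebra.
From mathcomp Require Import all_classical all_reals all_analysis.
From mathcomp Require Import ring lra.

Import Order.TTheory GRing.Theory Num.Theory.
Import numFieldNormedType.Exports.

Local Open Scope classical_set_scope.
Local Open Scope ring_scope.

Lemma normr_coord_le_enorm {R : realType} {n : nat} (x : 'rV[R]_n) (i : 'I_n) :
  `|x ord0 i| <= enorm x.
Proof.
rewrite -sqrtr_sqr ler_wsqrtr// (bigD1 i)//= lerDl.
by apply: sumr_ge0 => j _; exact: sqr_ge0.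
Qed.

Lemma linear_rate_le {R : realType} (L gamma kappa : R) (d : \bar R) (k : nat) :
  0 < L -> 0 <= gamma -> 1 <= kappa -> (0 < d)%E ->
  (kappa%:E * lne ((2 * L * gamma)%:E / d) <= k%:R%:E)%E ->
  (((1 - 1 / kappa) ^+ k * gamma)%:E <= d / (2 * L)%:E)%E.
Proof.
move=> L0 gamma0 kappa1 d0 dk.
have kappa0 : 0 < kappa by exact: lt_le_trans kappa1.
have L20 : 0 < 2 * L by rewrite mulr_gt0.
have iL : (2 * L)%:E^-1%E = (2 * L)^-1%:E by rewrite inver gt_eqF.
(* [0 < d] excludes [-oo], and for [d = +oo] the radius is [+oo]. *)
case: d d0 dk => [d| |]; rewrite ?lte_fin// => d0; last first.
  by rewrite iL gt0_mulye ?leey// lte_fin invr_gt0.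
rewrite inver gt_eqF//.
(* At [gamma = 0] the logarithm is [-oo] rather than a real number; the claim is then
   [0 <= d / (2 * L)]. *)
have [->|gamma_neq0] := eqVneq gamma 0.
  by move=> _; rewrite mulr0 iL -EFinM lee_fin divr_ge0 ?ltW.
have {gamma_neq0 gamma0}gamma0 : 0 < gamma by rewrite lt0r gamma_neq0.
have q0 : 0 < 2 * L * gamma / d by rewrite divr_gt0 ?mulr_gt0.
rewrite -EFinM lne_EFin// -EFinM lee_fin mulrC -ler_pdivlMr//.
(* Exponentiating turns the hypothesis into [2 * L * gamma / d <= expR (k / kappa)]. *)
rewrite -ler_expR lnK ?posrE// => qk.
rewrite iL -EFinM lee_fin ler_pdivlMr//.
have : (1 - 1 / kappa) ^+ k <= expR (- (k%:R / kappa)).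
  rewrite -[X in _ <= expR X]mulrN expRM_natl lerXn2r ?nnegrE ?expR_ge0//.
    by rewrite subr_ge0 div1r invf_le1.
  by rewrite div1r; exact: expR_ge1Dx.
move=> /(ler_wpM2r (ltW gamma0)) /(ler_wpM2r (ltW L20)) /le_trans; apply.
rewrite expRN -mulrA mulrC ler_pdivrMr ?expR_gt0// mulrC (mulrC d).
by rewrite -ler_pdivrMr.
Qed.

Section Subdifferential.
Context {R : realType}.
Implicit Types (h : R -> \bar R) (x v : R).

(** Tested at a point of the domain, the subgradient inequality rules out [h x = +oo]. *)
Lemma subdifferential_fin_num h x v :
  proper_fun h -> subdifferential h x v -> h x \is a fin_num.
Proof.
move=> [hNy [y hy]] /(_ y hy) hxy; rewrite fin_real// hNy/=.
move: (le_lt_trans hxy hy).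
by case: (h x) => [r||]; rewrite ?ltry ?ltNyr ?addye.
Qed.

(** For fixed [y], the subgradient inequality bounds the slope by a secant slope of [h], from above
    if [x < y] and from below if [y < x]. Such a bound passes from interior slopes to their supremum
    or infimum, hence to [v]. *)
Lemma subdifferential_closed_itv h x v : proper_fun h ->
  (subdifferential h x)° !=set0 ->
  (int_lower h x <= v%:E <= int_upper h x)%E -> subdifferential h x v.
Proof.
move=> hp [w0 w0D] /andP[lv vu] y hy.
have hx : h x \is a fin_num.
  exact: subdifferential_fin_num hp (interior_subset w0D).
have hyf : h y \is a fin_num by rewrite fin_real// hp.1.
have hint w : (subdifferential h x)° w -> fine (h x) + w * (y - x) <= fine (h y).
  move=> /interior_subset/(_ y hy).
  by rewrite -{1}(fineK hx) -{1}(fineK hyf) -EFinD lee_fin.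
rewrite -(fineK hx) -(fineK hyf) -EFinD lee_fin.
have [xy|yx|<-] := ltgtP x y; last first.
  by rewrite subrr mulr0 addr0.
- have d0 : 0 < x - y by rewrite subr_gt0.
  suff : (((fine (h x) - fine (h y)) / (x - y))%:E <= v%:E)%E.
    by rewrite lee_fin ler_pdivrMr//; lra.
  apply: le_trans lv; apply: le_ereal_inf_tmp => _ [w wD <-].
  by rewrite lee_fin ler_pdivrMr//; have := hint _ wD; lra.
- have d0 : 0 < y - x by rewrite subr_gt0.
  suff : (v%:E <= ((fine (h y) - fine (h x)) / (y - x))%:E)%E.
    by rewrite lee_fin ler_pdivlMr//; lra.
  apply: le_trans vu _; apply: ge_ereal_sup => _ [w wD <-].
  by rewrite lee_fin ler_pdivlMr//; have := hint _ wD; lra.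
Qed.

(** The slope [L * (w - x)] is minus the derivative at [x] of the quadratic term. Adding the
    subgradient inequality at [z] to the minimality of [z] against [x] leaves only the second-order
    term. *)
Lemma prox_unique h (L : R) (w x z : R) : 0 < L -> proper_fun h ->
  subdifferential h x (L * (w - x)) ->
  argmin (fun y => (L / 2 * (y - w) ^+ 2)%:E + h y)%E z -> z = x.
Proof.
move=> L0 hp hx /(_ x).
have hxf := subdifferential_fin_num _ _ _ hp hx.
rewrite -{1}(fineK hxf) -EFinD => zx.
have hz : dom h z.
  by rewrite /dom/=; move: zx; case: (h z) => [r||]; rewrite ?ltry ?ltNyr ?addey ?leye_eq.
have hzf : h z \is a fin_num by rewrite fin_real// hp.1.
move: zx (hx z hz); rewrite -(fineK hxf) -(fineK hzf) -!EFinD !lee_fin => zx xz.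
have : L / 2 * (z - x) ^+ 2 <= 0.
  have -> : L / 2 * (z - x) ^+ 2 = L / 2 * (z - w) ^+ 2 - L / 2 * (x - w) ^+ 2
    + L * (w - x) * (z - x) by field.
  by lra.
rewrite pmulr_rle0 ?divr_gt0// => zx0.
by apply/eqP; rewrite -subr_eq0 -sqrf_eq0 eq_le zx0 sqr_ge0.
Qed.

End Subdifferential.

Section ActiveSet.
Context {R : realType} {n : nat}.
Variables (f : 'rV[R]_n -> R) (g : 'I_n -> R -> \bar R) (xs : 'rV[R]_n).
Hypothesis xs_nondegenerate : nondegenerate_solution f g xs.

Lemma active_interior (i : 'I_n) : i \in active_set g xs ->
  (subdifferential (g i) (xs ord0 i))° (- partial f i xs).
Proof.
by rewrite inE => /asboolPn; exact: (xs_nondegenerate i).2.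
Qed.

(** Nondegeneracy puts [- partial f i xs] strictly between the endpoints for each active [i]; an
    empty minimum is [+oo]. *)
Lemma delta_gt0 : (0 < delta f g xs)%E.
Proof.
apply: lt_bigmin => // i /active_interior.
rewrite interior_subdifferentialE => -[li ui].
rewrite lt_min sube_gt0 li -[in X in (_ + X)%E](opprK (partial f i xs)).
by rewrite EFinN sube_gt0 ui.
Qed.

Lemma prox_identifies (L : R) (x : 'rV[R]_n) (i : 'I_n) (z : R) :
  0 < L -> lipschitz_gradient L f -> proper_fun (g i) ->
  i \in active_set g xs ->
  ((enorm (x - xs))%:E <= delta f g xs / (2 * L)%:E)%E ->
  argmin (fun y => (L / 2 * (y - (x ord0 i - 1 / L * partial f i x)) ^+ 2)%:E
                   + g i y)%E z ->
  z = xs ord0 i.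
Proof.
move=> L0 [_ flip] gp iZ xd; apply: prox_unique => //.
have iD := active_interior _ iZ.
have L20 : 0 < 2 * L by rewrite mulr_gt0.
set p := partial f i xs in iD *.
set v := L * _.
(* One factor [L] comes from the coordinate distance scaled by [L], the other from the Lipschitz
   gradient. *)
have vp : `|v + p| <= enorm (x - xs) * (2 * L).
  have := le_trans (normr_coord_le_enorm _ i) (flip x xs).
  have := normr_coord_le_enorm (x - xs) i.
  rewrite !mxE -/p => xi gi.
  have -> : v + p = L * (x ord0 i - xs ord0 i) - (partial f i x - p).
    by rewrite /v; field; rewrite gt_eqF.
  apply: (le_trans (ler_normB _ _)); rewrite normrM (gtr0_norm L0).
  by have := ler_wpM2l (ltW L0) xi; lra.
move: xd; rewrite inver gt_eqF// lee_pdivlMr// -EFinM => xd.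
have : (`|v + p|%:E <= delta f g xs)%E by apply: le_trans xd; rewrite lee_fin.
(* Thus [v] is no farther from [- p] than either endpoint of the interval is. *)
move=> /le_trans/(_ (bigmin_le_cond _ _ iZ)); rewrite le_min => /andP[vl vu].
apply: subdifferential_closed_itv => //; first by exists (- p).
have /andP[vpl vpu] : - `|v + p| <= v + p <= `|v + p| by rewrite -ler_norml.
move: vl vu; rewrite -/p lee_suber_addr// -leeBlDr// => vl vu; apply/andP; split.
- move: vl; case: (int_lower _ _) => [l| |]; rewrite ?leNye// -EFinD !lee_fin.
  by lra.
- by apply: le_trans vu; rewrite -EFinB lee_fin; lra.
Qed.

End ActiveSet.

Theorem theorem9 (R : realType) (n : nat)
    (f : 'rV[R]_n -> R) (g : 'I_n -> R -> \bar R) (L : R)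
    (xs : 'rV[R]_n) (b : nat -> {set 'I_n}) (x : nat -> 'rV[R]_n)
    (gamma kappa : R)
    (L_gt0 : 0 < L)
    (f_convex : convex_function (E := 'rV[R]_n) setT f)
    (f_smooth : lipschitz_gradient L f)
    (g_proper : forall i, proper_fun (g i))
    (g_lsc : forall i, lower_semicontinuous (g i))
    (g_convex : forall i, econvex (g i))
    (g_subdiff : forall i y, dom (g i) y -> subdifferential (g i) y !=set0)
    (xs_optimal : optimal f g xs)
    (xs_nondegenerate : nondegenerate_solution f g xs)
    (x_bcd : prox_bcd f g L b x)
    (gamma_ge0 : 0 <= gamma) (kappa_ge1 : 1 <= kappa)
    (x_rate : forall k, enorm (x k - xs) <= (1 - 1 / kappa) ^+ k * gamma) :
  (forall k : nat, (threshold f g L gamma kappa xs <= k%:R%:E)%E ->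
     ((enorm (x k - xs))%:E <= delta f g xs / (2 * L)%:E)%E)
  /\
  (forall kbar t : nat,
     least_nat (fun k => (threshold f g L gamma kappa xs <= k%:R%:E)%E) kbar ->
     (forall i, i \in active_set g xs -> x kbar ord0 i != xs ord0 i ->
        exists j : nat, (kbar <= j < kbar + t)%N /\ i \in b j) ->
     forall i, i \in active_set g xs ->
     forall k : nat, (kbar + t <= k)%N -> x k ord0 i = xs ord0 i).
Proof.
have near_xs k : (threshold f g L gamma kappa xs <= k%:R%:E)%E ->
    ((enorm (x k - xs))%:E <= delta f g xs / (2 * L)%:E)%E.
  move=> hk; apply: (@le_trans _ _ ((1 - 1 / kappa) ^+ k * gamma)%:E).
    by rewrite lee_fin.
  by apply: linear_rate_le => //; exact: delta_gt0.
split=> // kbar t [kbarP _] selected i iZ k.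
have step j : (kbar <= j)%N -> i \in b j -> x j.+1 ord0 i = xs ord0 i.
  move=> kj ibj; have [_ /(_ i)] := x_bcd j; rewrite ibj.
  apply: (prox_identifies _ _ _ xs_nondegenerate) => //.
  (* Every [j >= kbar] also meets the threshold. *)
  by apply/near_xs/(le_trans kbarP); rewrite lee_fin ler_nat.
have stay j m : (kbar <= j)%N -> x j ord0 i = xs ord0 i -> (j <= m)%N ->
    x m ord0 i = xs ord0 i.
  move=> kj xj /subnKC <-; elim: (m - j)%N => [|d IHd]; first by rewrite addn0.
  rewrite addnS; have [ibd|ibd] := boolP (i \in b (j + d)).
    by apply: step => //; rewrite (leq_trans kj)// leq_addr.
  by have [_ /(_ i)] := x_bcd (j + d)%N; rewrite (negbTE ibd) => ->.
(* [selected] covers only coordinates that are suboptimal at [kbar]; the others stay put from [kbar]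
   on. *)
move=> ktk; have [xkbar|xkbar] := eqVneq (x kbar ord0 i) (xs ord0 i).
  by apply: (stay kbar) => //; rewrite (leq_trans _ ktk)// leq_addr.
have [j [/andP[kj jt] ibj]] := selected i iZ xkbar.
(* Block [b j] produces iterate [j.+1], and [j < kbar + t] gives [j.+1 <= kbar + t <= k]. *)
apply: (stay j.+1); [exact: leqW|exact: step|exact: leq_trans ktk].
Qed.
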